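(* Let $a=\omega^{\omega^\lambda}$ be a principal ordinal and $W(a)=\{b:b<a\}$. Every pair of field-inherited operations $(+,\cdot)$ on $W(a)$ that satisfies properties (7) and (8) of the context coincides with the Hessenberg natural sum and natural product on $W(a)$.
   Context: $W(x)=\{z:z<x\}$; $s(b)$ is the successor of $b$. Field-inherited operations on $W(a)$: let $F$ be a linearly ordered field and $h:W(a)\to F$ an injective order-preserving map with $h(0)=0$, $h(1)=1$, $h(s(b))=h(b)+1$ for $b<a$, and such that $h(W(a))$ is closed under the addition and multiplication of $F$. The field-inherited operations are $x+y=h^{-1}(h(x)+h(y))$ and $x\cdot y=h^{-1}(h(x)h(y))$. Two sets of ordinals $A,B$ are cofinal with each other, written $cf(A)=cf(B)$, if each element of either is $\le$ some element of the other. Properties, for all $x,y\in W(a)$: (7) $cf(W(x+y))=cf\big((W(x)+y)\cup(x+W(y))\big)$. (8) $cf(W(x\cdot y))=cf\big(\{v\in W(a): h(v)=h(x)h(y')+h(x')h(y)-h(x')h(y')\text{ for some }x'<x,\ y'<y\}\big)$. Hessenberg operations: if $x=\sum_i\omega^{\xi_i}p_i$, $y=\sum_i\omega^{\xi_i}q_i$ are Cantor normal forms (padded with zero coefficients to a common set of exponents), the natural sum is $\sum_i\omega^{\xi_i}(p_i+q_i)$; the natural product is obtained by distributivity and associativity from $\omega^{\xi}\cdot\omega^{\eta}=\omega^{\xi(+)\eta}$, where $(+)$ is the natural sum. *)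

(* Defs.v *)
From HB Require Import structures.
From mathcomp Require Import all_boot all_order all_algebra.
From mathcomp Require Import boolp classical_sets functions.

Set Implicit Arguments.
Unset Strict Implicit.
Unset Printing Implicit Defensive.

Import Order.TTheory GRing.Theory Num.Theory.

Local Open Scope classical_set_scope.
Local Open Scope order_scope.
Local Open Scope quotient_scope.

(* [Node f] denotes the least ordinal strictly above all the [f i]; distinct
   trees may denote the same ordinal, whence the quotient [Ord] below. *)
Inductive tree : Type := Node (A : Type) of A -> tree.

Fixpoint tle (s t : tree) {struct s} : Prop :=
  let: Node A f := s in let: Node B g := t in
  forall i : A, exists j : B, tle (f i) (g j).

Lemma tle_refl s : tle s s.
Proof. by elim: s => A f IH i; exists i; exact: IH. Qed.

Lemma tle_trans t s u : tle s t -> tle t u -> tle s u.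
Proof.
elim: s t u => A f IH [B g] [C k] /= st tu i.
by have [j fg] := st i; have [l gk] := tu j; exists l; exact: IH fg gk.
Qed.

Definition tlt (s t : tree) : Prop :=
  let: Node B g := t in exists j : B, tle s (g j).

Lemma tle_Node (A : Type) (f : A -> tree) t :
  tle (Node f) t <-> forall i, tlt (f i) t.
Proof. by case: t. Qed.

Lemma tltNge s t : tlt s t <-> ~ tle t s.
Proof.
split.
  elim: s t => A f IH [B g] [j fg] /(_ j)[i gf].
  by apply: IH gf; move/tle_Node : fg; exact.
elim: s t => A f IH [B g] /existsNP[j /forallNP Nj]; exists j.
by apply/tle_Node => i; apply: IH; exact: Nj.
Qed.

Lemma tlt_le s t : tlt s t -> tle s t.
Proof.
elim: s t => A f IH [B g] [j fg]; apply/tle_Node => i; exists j.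
by apply: IH; move/tle_Node : fg; exact.
Qed.

Lemma tle_total s t : tle s t \/ tle t s.
Proof.
have [|/tltNge/tlt_le] := pselect (tle s t); [by left|by right].
Qed.

HB.instance Definition _ := gen_eqMixin tree.
HB.instance Definition _ := gen_choiceMixin tree.

Definition teq (s t : tree) : bool := `[< tle s t /\ tle t s >].

Lemma teq_refl : reflexive teq.
Proof. by move=> s; apply/asboolP; split; exact: tle_refl. Qed.

Lemma teq_sym : symmetric teq.
Proof. by move=> s t; apply/asboolP/asboolP => -[]. Qed.

Lemma teq_trans : transitive teq.
Proof.
move=> t s u /asboolP[st ts] /asboolP[tu ut].
by apply/asboolP; split; [exact: tle_trans st tu|exact: tle_trans ut ts].
Qed.

Canonical teq_equiv := EquivRel teq teq_refl teq_sym teq_trans.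

Definition Ord := {eq_quot teq_equiv}.

HB.instance Definition _ := Choice.on Ord.
HB.instance Definition _ := EqQuotient.on Ord.

Definition ole (x y : Ord) : bool := `[< tle (repr x) (repr y) >].

Lemma ole_pi s t : ole (\pi_Ord s) (\pi_Ord t) <-> tle s t.
Proof.
have reprE u : tle (repr (\pi_Ord u)) u /\ tle u (repr (\pi_Ord u)).
  suff /asboolP : teq (repr (\pi_Ord u)) u by [].
  by apply/(@eqquotP _ _ Ord); rewrite reprK.
have [[s1 s2] [t1 t2]] := (reprE s, reprE t).
split=> [/asboolP st|st]; last apply/asboolP.
  exact: tle_trans s2 (tle_trans st t1).
exact: tle_trans s1 (tle_trans st t2).
Qed.

Lemma ole_refl : reflexive ole.
Proof. by move=> x; apply/asboolP; exact: tle_refl. Qed.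

Lemma ole_anti : antisymmetric ole.
Proof.
move=> x y /andP[/asboolP xy /asboolP yx]; rewrite -(reprK x) -(reprK y).
by apply/(@eqquotP _ _ Ord)/asboolP.
Qed.

Lemma ole_trans : transitive ole.
Proof.
move=> y x z /asboolP xy /asboolP yz; apply/asboolP; exact: tle_trans xy yz.
Qed.

Lemma ole_total : total ole.
Proof.
move=> x y; have [xy|yx] := tle_total (repr x) (repr y).
  by apply/orP; left; apply/asboolP.
by apply/orP; right; apply/asboolP.
Qed.

Fact Ord_display : Order.disp_t. Proof. exact: Order.Disp tt tt. Qed.

HB.instance Definition _ :=
  Order.Le_isPOrder.Build Ord_display Ord ole_refl ole_anti ole_trans.
HB.instance Definition _ :=
  Order.POrder_isTotal.Build Ord_display Ord ole_total.


Lemma lt_Node (x : Ord) (B : Type) (g : B -> tree) :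
  x < \pi_Ord (Node g) <-> exists j, x <= \pi_Ord (g j).
Proof.
rewrite -(reprK x) ltNge; split.
  move=> /negP N; have /tltNge[j xg] : ~ tle (Node g) (repr x).
    by move=> gx; apply: N; apply/ole_pi.
  by exists j; apply/ole_pi.
move=> [j /ole_pi xg]; apply/negP => /ole_pi; apply/tltNge; by exists j.
Qed.

Definition lsub (A : Type) (f : A -> Ord) : Ord := \pi_Ord (Node (repr \o f)).

Lemma lsubP (A : Type) (f : A -> Ord) (x : Ord) :
  x < lsub f <-> exists i, x <= f i.
Proof. by rewrite lt_Node /=; split=> -[i]; exists i; move: p; rewrite reprK. Qed.

Definition ozero : Ord := lsub (fun i : False => match i with end).
Definition osucc (x : Ord) : Ord := lsub (fun _ : unit => x).
Definition onat (n : nat) : Ord := iter n osucc ozero.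
Definition omega : Ord := lsub onat.

Lemma ozero_ge0 (x : Ord) : ozero <= x.
Proof. by rewrite leNgt; apply/negP => /lsubP[[]]. Qed.

Lemma lt_osucc (x y : Ord) : (x < osucc y) = (x <= y).
Proof. by apply/idP/idP => [/lsubP[]|xy]; last by apply/lsubP; exists tt. Qed.

Lemma olt_wf : well_founded (fun x y : Ord => x < y).
Proof.
suff W t x : x <= \pi_Ord t -> Acc (fun x y : Ord => x < y) x.
  by move=> x; apply: (W (repr x)); rewrite reprK.
elim: t x => A f IH x xf; constructor => y yx.
by have /lt_Node[i] := lt_le_trans yx xf; exact: IH.
Qed.

Definition W (x : Ord) : set Ord := [set z | z < x].

Fixpoint subtrees (t : tree) : Type :=
  let: Node A f := t in {i : A & option (subtrees (f i))}.

Lemma small_W (x : Ord) :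
  exists (A : Type) (f : A -> Ord), forall y, y < x -> exists i, f i = y.
Proof.
have S t : exists f : subtrees t -> Ord,
    forall y, y < \pi_Ord t -> exists i, f i = y.
  elim: t => A f IH; pose g i := sval (cid (IH i)).
  have gP i : forall y, y < \pi_Ord (f i) -> exists v, g i v = y.
    exact: svalP (cid (IH i)).
  exists (fun u => if tagged u is Some v then g (tag u) v else \pi_Ord (f (tag u))).
  move=> y /lt_Node[i]; rewrite le_eqVlt => /orP[/eqP ->|/gP[v <-]].
    by exists (existT _ i None).
  by exists (existT _ i (Some v)).
by exists (subtrees (repr x)); have [f] := S (repr x); rewrite reprK; exists f.
Qed.

Lemma has_ubound_image (G : Ord -> Ord) (x : Ord) : has_ubound (G @` W x).
Proof.
have [I [f fP]] := small_W x; exists (lsub (G \o f)) => _ [y /fP[i <-] <-].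
by apply/ltW/lsubP; exists i.
Qed.

Lemma omin_ex (A : set Ord) : A !=set0 -> exists2 x, A x & lbound A x.
Proof.
move=> [x]; elim/(well_founded_ind olt_wf) : x => x IH Ax.
have [[y Ay yx]|N] := pselect (exists2 y, A y & y < x); first exact: IH Ay.
by exists x => // y Ay; rewrite leNgt; apply/negP => yx; apply: N; exists y.
Qed.

Definition osup (A : set Ord) : Ord := supremum ozero A.

Lemma osupP (A : set Ord) : has_ubound A -> isLub A (osup A).
Proof.
move=> uA; rewrite /osup /supremum; case: ifPn => [/eqP ->|_].
  by split=> [x //|b _]; exact: ozero_ge0.
have [m um lm] := omin_ex uA.
have : supremums A (xget ozero (supremums A)) by apply: xgetPex; exists m.
by case.
Qed.

(* Transfinite recursion, with the zero, successor and limit clauses merged: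
   [orec z g y] is the supremum of [z] and of the [g (orec z g y')], [y' < y].
   The usual clauses hold for monotone inflationary [g]: see [orec0], [orecS]
   and [orec_lim]. *)
Definition orec (z : Ord) (g : Ord -> Ord) : Ord -> Ord :=
  Fix olt_wf (fun _ => Ord) (fun y r =>
    osup [set u | u = z \/ exists y' (lt_y'y : y' < y), u = g (r y' lt_y'y)]).

Definition oadd (x : Ord) : Ord -> Ord := orec x osucc.
Definition omul (x : Ord) : Ord -> Ord := orec ozero (oadd^~ x).
Definition oexp (x : Ord) : Ord -> Ord := orec (onat 1) (omul^~ x).

Lemma orecE z g y :
  orec z g y = osup (z |` [set g (orec z g y') | y' in W y]).
Proof.
rewrite /orec Fix_eq; last first.
  move=> {}y r s rs; congr osup; apply/seteqP.
  by split=> u [->|[y' [lt_y'y ->]]]; [left|right|left|right] => //;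
    exists y', lt_y'y; rewrite rs.
congr osup; apply/seteqP; split=> u /=.
  by move=> [->|[y' [y'y ->]]]; [left|right; exists y'].
by move=> [->|[y' y'y <-]]; [left|right; exists y', y'y].
Qed.

Lemma orec_lub z g y :
  isLub (z |` [set g (orec z g y') | y' in W y]) (orec z g y).
Proof.
rewrite orecE; apply: osupP.
have [u uP] := has_ubound_image (g \o orec z g) y.
exists (Order.max z u) => v [->|gv]; first by rewrite le_max lexx.
by rewrite le_max uP ?orbT.
Qed.

Lemma orec_le z g : {homo orec z g : x y / x <= y}.
Proof.
move=> x y xy; apply: (orec_lub z g x).2 => u [->|[x' x'x <-]].
  by apply: (orec_lub z g y).1; left.
by apply: (orec_lub z g y).1; right; exists x' => //; exact: lt_le_trans xy.
Qed.

Lemma orec0 z g : orec z g ozero = z.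
Proof.
apply/le_anti/andP; split; last by apply: (orec_lub z g _).1; left.
by apply: (orec_lub z g _).2 => u [->//|[x]]; rewrite /W/= ltNge ozero_ge0.
Qed.

Lemma orecS z g y : {homo g : u v / u <= v} -> (forall u, z <= u -> u <= g u) ->
  orec z g (osucc y) = g (orec z g y).
Proof.
move=> g_le le_g; apply/le_anti/andP; split.
  apply: (orec_lub z g _).2 => u [->|[x]]; last first.
    by rewrite /W/= lt_osucc => xy <-; exact/g_le/orec_le.
  have zy : z <= orec z g y by apply: (orec_lub z g _).1; left.
  exact: le_trans zy (le_g _ zy).
apply: (orec_lub z g _).1; right; exists y => //.
by rewrite /W/= lt_osucc.
Qed.

Lemma orec_lim z g y :
  {homo g : u v / u <= v} -> (forall u, z <= u -> u <= g u) ->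
  ozero < y -> (forall x, x < y -> osucc x < y) ->
  isLub [set orec z g x | x in W y] (orec z g y).
Proof.
move=> g_le le_g y0 yS; split=> [_ [x xy <-]|b bP].
  exact/orec_le/ltW.
apply: (orec_lub z g _).2 => u [->|[x xy <-]].
  by rewrite -(orec0 z g); apply: bP; exists ozero.
by rewrite -orecS //; apply: bP; exists (osucc x) => //; exact: yS.
Qed.

Lemma oaddS x y : oadd x (osucc y) = osucc (oadd x y).
Proof.
apply: orecS => [u v uv|u _]; last by rewrite ltW // lt_osucc.
by rewrite leNgt; apply/negP; rewrite lt_osucc leNgt lt_osucc uv.
Qed.

Lemma osucc_le (x y : Ord) : (osucc x <= y) = (x < y).
Proof. by rewrite leNgt lt_osucc -ltNge. Qed.

Lemma orec_homo z z' g g' y : z <= z' ->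
    (forall u v, u <= v -> g u <= g' v) -> orec z g y <= orec z' g' y.
Proof.
move=> zz' gg'; elim/(well_founded_ind olt_wf) : y => y IH.
apply: (orec_lub z g y).2 => u [->|[x xy <-]].
  by apply: le_trans zz' _; apply: (orec_lub z' g' y).1; left.
apply: le_trans (gg' _ _ (IH x xy)) _.
by apply: (orec_lub z' g' y).1; right; exists x.
Qed.

Lemma oadd0 x : oadd x ozero = x.
Proof. exact: orec0. Qed.

Lemma oadd_ltr x y y' : y' < y -> oadd x y' < oadd x y.
Proof. by rewrite -!osucc_le -oaddS; exact: orec_le. Qed.

Lemma oadd_lel x x' y : x <= x' -> oadd x y <= oadd x' y.
Proof. by move=> xx'; apply: orec_homo => // u v; rewrite osucc_le lt_osucc. Qed.

Lemma oadd_gel x y : x <= oadd x y.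
Proof. by rewrite -{1}(oadd0 x); exact/orec_le/ozero_ge0. Qed.

Lemma oadd_ger x y : y <= oadd x y.
Proof.
elim/(well_founded_ind olt_wf) : y => y IH; rewrite leNgt; apply/negP => yx.
by have := IH _ yx; rewrite leNgt => /negP; apply; exact: oadd_ltr.
Qed.

Lemma add0o y : oadd ozero y = y.
Proof.
elim/(well_founded_ind olt_wf) : y => y IH.
apply/le_anti; rewrite oadd_ger andbT; apply: (orec_lub ozero osucc y).2.
move=> u [->|[z zy <-]]; first exact: ozero_ge0.
by rewrite [orec _ _ _]IH// osucc_le.
Qed.

Lemma oadd_lim x y : ozero < y -> (forall z, z < y -> osucc z < y) ->
  isLub [set oadd x z | z in W y] (oadd x y).
Proof.
apply: orec_lim => [u v|u _]; first by rewrite osucc_le lt_osucc.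
by rewrite ltW // lt_osucc.
Qed.

Lemma omul0 x : omul x ozero = ozero.
Proof. exact: orec0. Qed.

Lemma omulS x y : omul x (osucc y) = oadd (omul x y) x.
Proof. by apply: orecS => [u v|u _]; [exact: oadd_lel|exact: oadd_gel]. Qed.

Lemma omul_lim x y : ozero < y -> (forall z, z < y -> osucc z < y) ->
  isLub [set omul x z | z in W y] (omul x y).
Proof. by apply: orec_lim => [u v|u _]; [exact: oadd_lel|exact: oadd_gel]. Qed.

Lemma omul_lel x x' y : x <= x' -> omul x y <= omul x' y.
Proof.
move=> xx'; apply: orec_homo => // u v uv.
exact: le_trans (oadd_lel _ uv) (orec_le _ _ xx').
Qed.

Lemma omul_gel x y : ozero < y -> x <= omul x y.
Proof.
rewrite -osucc_le => y0; apply: le_trans (orec_le _ _ y0).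
by rewrite [leRHS]omulS; exact: oadd_ger.
Qed.

Lemma oexp0 x : oexp x ozero = onat 1.
Proof. exact: orec0. Qed.

Lemma oexpS x y : ozero < x -> oexp x (osucc y) = omul (oexp x y) x.
Proof.
by move=> x0; apply: orecS => [u v|u _]; [exact: omul_lel|exact: omul_gel].
Qed.

Lemma oexp_lim x y : ozero < x ->
  ozero < y -> (forall z, z < y -> osucc z < y) ->
  isLub [set oexp x z | z in W y] (oexp x y).
Proof.
move=> x0; apply: orec_lim => [u v|u _]; first exact: omul_lel.
exact: omul_gel.
Qed.

Definition cnf_val (s : seq (Ord * nat)) : Ord :=
  \big[oadd/ozero]_(t <- s) omul (oexp omega t.1) (onat t.2).

(* [[:: (xi_1, p_1); ...; (xi_n, p_n)]] is the Cantor normal form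
   [omega ^ xi_1 p_1 + ... + omega ^ xi_n p_n] of [x]. *)
Definition is_cnf (x : Ord) (s : seq (Ord * nat)) : Prop :=
  [/\ sorted >%O (unzip1 s), all (fun t => 0 < t.2)%N s & cnf_val s = x].

Lemma onat_omega n : onat n < omega.
Proof. by apply/lsubP; exists n. Qed.

Lemma lt_omega x : x < omega -> exists n, x = onat n.
Proof.
move=> /lsubP[n]; elim: n => [|n IH]; last first.
  by rewrite le_eqVlt => /orP[/eqP ->|]; [exists n.+1|rewrite lt_osucc].
by move=> x0; exists 0%N; apply/le_anti; rewrite x0 ozero_ge0.
Qed.

Lemma oadd_sub x z : x <= z -> exists r, oadd x r = z.
Proof.
move=> xz.
have [|r zr rP] := @omin_ex [set r | z <= oadd x r].
  by exists z; exact: oadd_ger.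
exists r; apply/le_anti; rewrite [X in _ && X]zr andbT.
apply: (orec_lub x osucc r).2 => u [->//|[r' r'r <-]].
rewrite osucc_le ltNge; apply/negP => /rP; rewrite leNgt => /negP; exact.
Qed.

Lemma lt_orec z g y x : x < orec z g y ->
  x < z \/ exists2 y', y' < y & x < g (orec z g y').
Proof.
move=> xy; apply: contrapT => /not_orP[/negP]; rewrite -leNgt => zx N.
move: xy; rewrite ltNge => /negP; apply; apply: (orec_lub z g y).2.
move=> u [->//|[y' y'y <-]]; rewrite leNgt; apply/negP => xg.
by apply: N; exists y'.
Qed.

Lemma omul_div b x : x < omul b omega ->
  exists n r, r < b /\ x = oadd (omul b (onat n)) r.
Proof.
move=> /lt_orec[|[y /lt_omega[m ->] xm]]; first by rewrite ltNge ozero_ge0.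
have /ex_minnP[n xn nP] : exists n, x < omul b (onat n.+1).
  by exists m; rewrite [onat _]/= omulS.
have bx : omul b (onat n) <= x.
  case: n {xn} nP => [|n] nP; first by rewrite [onat _]/= omul0 ozero_ge0.
  by rewrite leNgt; apply/negP => /nP; rewrite ltnn.
have [r rx] := oadd_sub bx; exists n, r; split=> //.
rewrite ltNge; apply/negP => br; move: xn.
by rewrite [onat _]/= omulS -rx ltNge => /negP; apply; exact: orec_le.
Qed.

Lemma omega_gt0 : ozero < omega. Proof. exact: (onat_omega 0). Qed.

Lemma oexp_gt0 y : ozero < oexp omega y.
Proof.
by rewrite -osucc_le -[leLHS](oexp0 omega); apply: orec_le; exact: ozero_ge0.
Qed.

Lemma oexp_ltr y y' : y' < y -> oexp omega y' < oexp omega y.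
Proof.
move=> y'y; apply: (@lt_le_trans _ _ (oexp omega (osucc y'))); last first.
  by apply: orec_le; rewrite osucc_le.
rewrite oexpS ?omega_gt0//.
apply: (@lt_le_trans _ _ (omul (oexp omega y') (onat 2))); last first.
  exact/orec_le/ltW/onat_omega.
rewrite [onat _]/= !omulS omul0 -{1}(oadd0 (oexp _ _)).
apply: lt_le_trans (oadd_lel _ (oadd_ger _ _)).
exact/oadd_ltr/oexp_gt0.
Qed.

Lemma oexp_ger y : y <= oexp omega y.
Proof.
elim/(well_founded_ind olt_wf) : y => y IH; rewrite leNgt; apply/negP => yx.
by have := IH _ yx; rewrite leNgt => /negP; apply; exact: oexp_ltr.
Qed.

Lemma is_cnf_ex x : exists s, is_cnf x s.
Proof.
elim/(well_founded_ind olt_wf) : x => x IH.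
have [->|x0] := eqVneq x ozero.
  by exists [::]; split => //; rewrite /cnf_val big_nil.
have {}x0 : ozero < x by rewrite lt_neqAle eq_sym x0 ozero_ge0.
have [|z xz zP] := @omin_ex [set z | x < oexp omega z].
  exists (osucc x); apply: le_lt_trans (oexp_ger x) _.
  by apply: oexp_ltr; rewrite lt_osucc.
have [|[e ez xe]] := lt_orec xz; first by rewrite lt_osucc leNgt x0.
have ex : oexp omega e <= x.
  by rewrite leNgt; apply/negP => /zP; rewrite leNgt ez.
have [n [r [re xE]]] := omul_div xe.
have n0 : (0 < n)%N.
  case: n xE => // xE; move: ex; rewrite leNgt => /negP; case.
  by rewrite xE [onat _]/= omul0 add0o.
have [s [s_sort s_pos sr]] := IH r (lt_le_trans re ex).
exists ((e, n) :: s); split => /=; last 2 first.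
- by rewrite n0.
- by rewrite /cnf_val big_cons -[X in oadd _ X]/(cnf_val s) sr.
case: s s_sort s_pos sr => //= -[f p] s /= -> /andP[p0 _] sr; rewrite andbT.
rewrite ltNge; apply/negP => ef; move: re; rewrite ltNge => /negP; apply.
apply: le_trans (orec_le _ _ ef) _; rewrite -sr /cnf_val big_cons.
apply: le_trans (oadd_gel _ _); apply: omul_gel => /=.
by case: p p0 {sr} => // p _; rewrite lt_osucc ozero_ge0.
Qed.

Definition cnf (x : Ord) : seq (Ord * nat) := xget [::] (is_cnf x).

Lemma cnfP x : is_cnf x (cnf x).
Proof. exact: (@xgetPex _ [::] (is_cnf x) (is_cnf_ex x)). Qed.

(* The coefficient of [omega ^ xi] in the normal form of [x], 0 if absent. *)
Definition coef_cnf (x xi : Ord) : nat :=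
  (\sum_(t <- cnf x | t.1 == xi) t.2)%N.

Definition hsum (x y : Ord) : Ord :=
  cnf_val [seq (xi, coef_cnf x xi + coef_cnf y xi)%N
          | xi <- sort >=%O (undup (unzip1 (cnf x) ++ unzip1 (cnf y)))].

Definition hprod (x y : Ord) : Ord :=
  \big[hsum/ozero]_(t <- cnf x) \big[hsum/ozero]_(u <- cnf y)
    omul (oexp omega (hsum t.1 u.1)) (onat (t.2 * u.2)).

Local Close Scope order_scope.
Local Open Scope ring_scope.

(* [h] stands for a map [W a -> F]: its values outside [W a] play no role, here
   and in [fadd], [fmul], which invert [h] on [W a] only. *)
Record field_embedding (a : Ord) (F : realFieldType) (h : Ord -> F) : Prop := {
  emb_le : {in W a &, {homo h : x y / (x <= y)%O >-> x <= y}} ;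
  emb_inj : {in W a &, injective h} ;
  emb0 : h ozero = 0 ;
  emb1 : h (onat 1) = 1 ;
  embS : forall b, W a b -> h (osucc b) = h b + 1 ;
  emb_addr_closed : forall x y, (h @` W a) x -> (h @` W a) y ->
    (h @` W a) (x + y) ;
  emb_mulr_closed : forall x y, (h @` W a) x -> (h @` W a) y ->
    (h @` W a) (x * y) }.

Definition cofinal (A B : set Ord) : Prop :=
  (forall x, A x -> exists2 y, B y & (x <= y)%O) /\
  (forall y, B y -> exists2 x, A x & (y <= x)%O).

Section field_inherited.
Context (a : Ord) (F : realFieldType) (h : Ord -> F).

Definition hinv : F -> Ord := 'pinv_(fun=> ozero) (W a) h.
Definition fadd (x y : Ord) : Ord := hinv (h x + h y).
Definition fmul (x y : Ord) : Ord := hinv (h x * h y).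

Definition sum_cofinal : Prop := forall x y, W a x -> W a y ->
  cofinal (W (fadd x y))
    ([set fadd x' y | x' in W x] `|` [set fadd x y' | y' in W y]).

Definition prod_cofinal : Prop := forall x y, W a x -> W a y ->
  cofinal (W (fmul x y))
    [set v | W a v /\ exists x' y', [/\ W x x', W y y' &
       h v = h x * h y' + h x' * h y - h x' * h y']].

End field_inherited.

(* Main.v *)
Require Import Defs.
From mathcomp Require Import all_boot all_order all_algebra.
From mathcomp Require Import boolp classical_sets functions.

(** By (7), [x + y] is the least ordinal above all [x' + y] and [x + y'], so it
    is at least the ordinary sum, and an induction on [e] gives
    [omega^e n + r] its ordinary value for [r < omega^e]. Hence [h] turns Cantor
    normal forms into sums, [h x = \sum n_i h (omega^e_i)], and the sum is the
    Hessenberg one. By distributivity it remains to multiply powers of [omega],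
    by induction on both exponents. That the product is at least
    [omega^(xi (+) eta)] follows from monotonicity, applying (7) to the
    exponents; for the converse, (8) bounds the product by ordinals
    [v <= x y' + x' y] with [x' < x = omega^xi] and [y' < y = omega^eta], and
    [omega^(xi (+) eta)] is closed under sums. *)

Set Implicit Arguments.
Unset Strict Implicit.
Unset Printing Implicit Defensive.

Import Order.TTheory GRing.Theory Num.Theory.

Local Open Scope classical_set_scope.
Local Open Scope ring_scope.
Local Open Scope order_scope.

(** * Ordinal arithmetic below powers of [omega] *)

Lemma olt_ind (P : Ord -> Prop) :
  (forall x, (forall y, y < x -> P y) -> P x) -> forall x, P x.
Proof. by move=> IH x; apply: (well_founded_ind olt_wf). Qed.

Lemma onat_le m n : (m <= n)%N -> onat m <= onat n.
Proof.
move=> /subnK <-; elim: (n - m)%N => // k IH.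
by rewrite addSn; apply: le_trans IH (ltW _); rewrite /= lt_osucc.
Qed.

Lemma omul1 x : omul x (onat 1) = x.
Proof. by rewrite /= omulS omul0 add0o. Qed.

Lemma omul_onat_le x m n :
  (m <= n)%N -> omul x (onat m) <= omul x (onat n).
Proof. by move=> mn; exact/orec_le/onat_le. Qed.

Lemma omul_divn b n x : x < omul b (onat n) ->
  exists m r, [/\ (m < n)%N, r < b & x = oadd (omul b (onat m)) r].
Proof.
move=> xn; have [|m [r [rb xE]]] := @omul_div b x.
  by apply: lt_le_trans xn _; exact/orec_le/ltW/onat_omega.
exists m, r; split=> //; rewrite ltnNge; apply/negP => /(omul_onat_le b).
by rewrite leNgt => /negP; apply; apply: le_lt_trans xn; rewrite xE oadd_gel.
Qed.

(** Unfolding the recursions of [oexp] and of [omul] once each treats successor and limit exponents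
    alike, so no later argument distinguishes them. *)
Lemma lt_oexp_split e x : x < oexp omega e ->
  x = ozero \/ exists e' n, e' < e /\ x < omul (oexp omega e') (onat n).
Proof.
move=> /lt_orec[|[e' e'e /lt_orec[|[y /lt_omega[n ->] xn]]]].
- rewrite lt_osucc => x0; left; apply/le_anti.
  by rewrite x0 ozero_ge0.
- by rewrite ltNge ozero_ge0.
- by right; exists e', n.+1; split=> //; rewrite /= omulS.
Qed.

Lemma omul_onat_lt_oexp e e' n :
  e' < e -> omul (oexp omega e') (onat n) < oexp omega e.
Proof.
rewrite -osucc_le => e'e.
apply: (@lt_le_trans _ _ (omul (oexp omega e') (onat n.+1))).
  by rewrite /= omulS -{1}(oadd0 (omul _ _)) oadd_ltr// oexp_gt0.
apply: le_trans (orec_le _ _ e'e); rewrite [leRHS]oexpS ?omega_gt0//.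
exact/orec_le/ltW/onat_omega.
Qed.

(** * The field-inherited operations and their transfer to [F] *)

Section field_inherited_operations.
Context (a : Ord) (F : realFieldType) (h : Ord -> F).
Context (h_emb : field_embedding a h) (a_gt1 : onat 1 < a).

Local Notation add := (fadd a h).
Local Notation mul := (fmul a h).
Local Notation w := (oexp omega).
Local Notation wn e n := (omul (oexp omega e) (onat n)).

Lemma emb_leE x y : x < a -> y < a -> (h x <= h y) = (x <= y).
Proof.
move=> xa ya; apply/idP/idP; last by apply: (emb_le h_emb); rewrite inE.
move=> hxy; rewrite leNgt; apply/negP => yx; move: (yx); rewrite lt_neqAle.
case/andP => /eqP + _; apply; apply: (emb_inj h_emb); rewrite ?inE//.
apply/le_anti; rewrite hxy andbT.
by apply: (emb_le h_emb) (ltW yx); rewrite inE.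
Qed.

Lemma emb_ltE x y : x < a -> y < a -> (h x < h y) = (x < y).
Proof. by move=> xa ya; rewrite !ltNge emb_leE. Qed.

Lemma emb_eq x y : x < a -> y < a -> h x = h y -> x = y.
Proof. by move=> xa ya; apply: (emb_inj h_emb); rewrite inE. Qed.

Lemma emb_ge0 x : x < a -> (0 <= h x)%R.
Proof.
move=> xa; rewrite -(emb0 h_emb) emb_leE ?ozero_ge0//.
exact: le_lt_trans (ozero_ge0 x) xa.
Qed.

Lemma hinvK x : x < a -> hinv a h (h x) = x.
Proof. by move=> xa; apply: pinvKV; rewrite ?inE//; exact: emb_inj. Qed.

Lemma faddP x y : x < a -> y < a -> add x y < a /\ h (add x y) = (h x + h y)%R.
Proof.
move=> xa ya; have [||z za hz] := @emb_addr_closed _ _ _ h_emb (h x) (h y).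
- by exists x.
- by exists y.
by rewrite /fadd -hz hinvK.
Qed.

Lemma fmulP x y : x < a -> y < a -> mul x y < a /\ h (mul x y) = (h x * h y)%R.
Proof.
move=> xa ya; have [||z za hz] := @emb_mulr_closed _ _ _ h_emb (h x) (h y).
- by exists x.
- by exists y.
by rewrite /fmul -hz hinvK.
Qed.

Lemma fadd_lt x y : x < a -> y < a -> add x y < a.
Proof. by move=> xa ya; have [] := faddP xa ya. Qed.

Lemma emb_fadd x y : x < a -> y < a -> h (add x y) = (h x + h y)%R.
Proof. by move=> xa ya; have [] := faddP xa ya. Qed.

Lemma faddC x y : add x y = add y x.
Proof. by rewrite /fadd addrC. Qed.

Lemma faddA x y z : x < a -> y < a -> z < a ->
  add x (add y z) = add (add x y) z.
Proof.
move=> xa ya za; rewrite /fadd.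
by rewrite !(emb_fadd xa ya, emb_fadd ya za) addrA.
Qed.

Lemma fadd0 x : x < a -> add x ozero = x.
Proof. by move=> xa; rewrite /fadd (emb0 h_emb) addr0 hinvK. Qed.

Lemma fadd_ltr x y z : x < a -> y < a -> z < y -> add x z < add x y.
Proof.
move=> xa ya zy; have za := lt_trans zy ya.
by rewrite -emb_ltE ?fadd_lt// !emb_fadd// ltrD2l emb_ltE.
Qed.

Lemma fadd_ltl x y z : x < a -> y < a -> z < y -> add z x < add y x.
Proof. by move=> *; rewrite ![add _ x]faddC fadd_ltr. Qed.

(** [add x] is strictly increasing with values at least [x], and [oadd x] is the least such
    function. *)
Lemma oadd_le_fadd x y : x < a -> y < a -> oadd x y <= add x y.
Proof.
move=> xa; elim/olt_ind: y => y IH ya; apply: (orec_lub x osucc y).2.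
move=> u [->|[z zy <-]].
  rewrite -emb_leE ?fadd_lt// emb_fadd// -[leLHS]addr0.
  by rewrite lerD2l emb_ge0.
rewrite osucc_le; apply: le_lt_trans (fadd_ltr xa ya zy).
exact: IH zy (lt_trans zy ya).
Qed.

Lemma oadd_lt x y : x < a -> y < a -> oadd x y < a.
Proof.
by move=> xa ya; apply: le_lt_trans (oadd_le_fadd xa ya) (fadd_lt xa ya).
Qed.

Lemma omul_onat_lt x n : x < a -> omul x (onat n) < a.
Proof.
move=> xa; elim: n => [|n IH] /=; last by rewrite omulS oadd_lt.
by rewrite omul0; apply: le_lt_trans (ozero_ge0 x) xa.
Qed.

(** * Property (7): multiples and powers of [omega] *)

Section cofinality.
Context (h_sum : sum_cofinal a h).

Lemma fadd_leP x y b : x < a -> y < a ->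
  (forall x', x' < x -> add x' y < b) ->
  (forall y', y' < y -> add x y' < b) -> add x y <= b.
Proof.
move=> xa ya xb yb; rewrite leNgt; apply/negP => /((h_sum xa ya).1 b)[v].
by move=> [[x' x'x <-]|[y' y'y <-]]; rewrite leNgt => /negP; apply; auto.
Qed.

Lemma lt_fadd x y z : x < a -> y < a -> z < add x y ->
  (exists2 x', x' < x & z <= add x' y) \/ (exists2 y', y' < y & z <= add x y').
Proof.
move=> xa ya /((h_sum xa ya).1 z)[v [[x' x'x <-]|[y' y'y <-]] zv].
  by left; exists x'.
by right; exists y'.
Qed.

Section multiples.
Context (u : Ord) (ua : u < a).
Context (u_add : forall s r, s < u -> r < u -> add s r < u).

Local Notation un n := (omul u (onat n)).

(** Induction on [n], then on [r]. An [x' < un n] is [un m + s] with [m < n] and [s < u]; as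
    [s + r < u], the outer hypothesis makes [x' + r = un m + (s + r)] an ordinary sum, below
    [un m.+1 <= un n]. *)
Lemma fadd_multiple_rem n r : r < u -> add (un n) r = oadd (un n) r.
Proof.
have una k : un k < a by exact: omul_onat_lt.
elim/ltn_ind: n r => n IHn; elim/olt_ind => r IHr ru.
have ra := lt_trans ru ua.
apply/le_anti; rewrite oadd_le_fadd// andbT.
apply: fadd_leP => // [x' x'n|r' r'r].
  have [m [s [mn su ->]]] := omul_divn x'n.
  have sa := lt_trans su ua.
  rewrite -(IHn m mn s su) -faddA// (IHn m mn _ (u_add su ru)).
  apply: lt_le_trans (oadd_gel _ _).
  apply: lt_le_trans (omul_onat_le u mn); rewrite /= omulS.
  exact/oadd_ltr/u_add.
by rewrite (IHr _ r'r (lt_trans r'r ru)) oadd_ltr.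
Qed.

(** The remainder is now [u] itself, so [s + u] may leave [W u]. Commuting helps:
    [un m + s + u = un m.+1 + s] by induction, which is below [un m.+2 <= un n.+1]. *)
Lemma fadd_multiple_base n : add (un n) u = un n.+1.
Proof.
have una k : un k < a by exact: omul_onat_lt.
elim/ltn_ind: n => n IH; apply/le_anti.
rewrite [X in _ && X]/= omulS oadd_le_fadd// andbT.
apply: fadd_leP => // [x' x'n|r ru].
  have [m [s [mn su ->]]] := omul_divn x'n.
  have sa := lt_trans su ua.
  rewrite -fadd_multiple_rem// -faddA// [add s u]faddC faddA// IH//.
  rewrite fadd_multiple_rem//; apply: (@lt_le_trans _ _ (un m.+2)).
    by rewrite [ltRHS]/= [ltRHS]omulS oadd_ltr.
  by rewrite -omulS; apply: (@omul_onat_le u m.+2 n.+1).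
by rewrite fadd_multiple_rem// oadd_ltr.
Qed.

Lemma emb_multiple n : h (un n) = (h u *+ n)%R.
Proof.
elim: n => [|n IH]; first by rewrite /= omul0 (emb0 h_emb) mulr0n.
by rewrite -fadd_multiple_base emb_fadd ?omul_onat_lt// IH mulrSr.
Qed.

End multiples.

(** By induction, [w e'] with [e' < e] is closed under [add], so [h] is additive on its multiples.
    Bounding [s] and [r] by multiples of one [w e'] bounds their sum by another, still below
    [w e]. *)
Lemma fadd_lt_oexp e s r : w e < a -> s < w e -> r < w e -> add s r < w e.
Proof.
elim/olt_ind: e s r => e IH s r ea se re.
have sa := lt_trans se ea; have ra := lt_trans re ea.
have a0 : ozero < a by apply: le_lt_trans (ozero_ge0 _) ea.
have [->|[e1 [n1 [e1e sn]]]] := lt_oexp_split se.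
  by rewrite faddC fadd0.
have [->|[e2 [n2 [e2e rn]]]] := lt_oexp_split re; first by rewrite fadd0.
have step e' n m : e' < e -> s < wn e' n -> r < wn e' m -> add s r < w e.
  move=> e'e {}sn {}rn.
  have e'a : w e' < a by apply: lt_trans ea; exact: oexp_ltr.
  have e'_add s' r' : s' < w e' -> r' < w e' -> add s' r' < w e' by exact: IH.
  apply: (lt_trans _ (omul_onat_lt_oexp (n + m) e'e)).
  have e'na k : wn e' k < a by exact: omul_onat_lt.
  rewrite -emb_ltE ?fadd_lt// emb_fadd// emb_multiple//.
  by rewrite mulrnDr -!emb_multiple// ltrD ?emb_ltE.
(* Used to bring the two bounds to the larger of their exponents. *)
have grow e' f n : e' < f -> wn e' n <= wn f 1.
  by move=> ef; rewrite omul1; exact/ltW/omul_onat_lt_oexp.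
have [e12|e21|ee] := ltgtP e1 e2.
- exact: step e2e (lt_le_trans sn (grow _ _ _ e12)) rn.
- exact: step e1e sn (lt_le_trans rn (grow _ _ _ e21)).
- by apply: (step e1 n1 n2) => //; rewrite ee.
Qed.

(** * Cantor normal forms and the natural sum *)

Lemma emb_oexp_mul e n : w e < a -> h (wn e n) = (h (w e) *+ n)%R.
Proof.
move=> ea; apply: emb_multiple => // s r; exact: fadd_lt_oexp.
Qed.

(** The last clause drives the induction: it puts the tail below the leading power, where [oadd] and
    [add] agree, so that [h] splits off the leading term. *)
Lemma cnf_valP (s : seq (Ord * nat)) :
    sorted >%O (unzip1 s) -> (forall t, t \in s -> w t.1 < a) ->
  [/\ cnf_val s < a,
      h (cnf_val s) = (\sum_(t <- s) h (w t.1) *+ t.2)%R &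
      forall e, (forall t, t \in s -> t.1 < e) -> w e < a -> cnf_val s < w e].
Proof.
rewrite /cnf_val; elim: s => [|[e n] s IH] /=.
  rewrite !big_nil (emb0 h_emb) => _ _; split=> // [|e _ _].
    exact: le_lt_trans (ozero_ge0 _) a_gt1.
  exact: oexp_gt0.
move=> es sa; have ea : w e < a by have := sa (e, n); rewrite inE eqxx; apply.
have [||ca hc c_lt] := IH; first exact: path_sorted es.
  by move=> t ts; apply: sa; rewrite inE ts orbT.
rewrite !big_cons/=; set c := (X in oadd _ X) in ca hc c_lt *.
have ce : c < w e.
  apply: c_lt => // t ts; move: es; rewrite path_sortedE; last first.
    by move=> y x z /[swap]; exact: lt_trans.
  by case/andP => /allP + _; apply; apply/mapP; exists t.
have cE : oadd (wn e n) c = add (wn e n) c.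
  by rewrite fadd_multiple_rem// => x y; exact: fadd_lt_oexp.
rewrite cE; split; first by rewrite fadd_lt ?omul_onat_lt.
  by rewrite emb_fadd ?omul_onat_lt// hc emb_oexp_mul.
move=> f ef fa; apply: fadd_lt_oexp => //.
  by apply: omul_onat_lt_oexp; have := ef (e, n); rewrite inE eqxx; apply.
by apply: c_lt => // t ts; apply: ef; rewrite inE ts orbT.
Qed.

Lemma cnf_exp_lt x t : x < a -> t \in cnf x -> w t.1 < a.
Proof.
move=> xa; have [_ + xE] := cnfP x; rewrite -xE in xa => {xE}.
elim: (cnf x) xa => // t' s IH; rewrite /cnf_val big_cons /= => sa.
case/andP => t'0 s0; rewrite inE => /orP[/eqP ->|ts].
  apply: le_lt_trans sa; apply: le_trans (oadd_gel _ _).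
  by apply: omul_gel; case: t'.2 t'0 => // n _; rewrite lt_osucc ozero_ge0.
by apply: IH => //; apply: le_lt_trans sa; exact: oadd_ger.
Qed.

Lemma emb_cnf x : x < a -> h x = (\sum_(t <- cnf x) h (w t.1) *+ t.2)%R.
Proof.
move=> xa; have [x_sort _ xE] := cnfP x.
have [_ <- _] := cnf_valP x_sort (fun t => @cnf_exp_lt x t xa).
by rewrite xE.
Qed.

(** Pads the normal form with zero coefficients, so that two ordinals can be expanded over the same
    exponents. *)
Lemma emb_coef_cnf x (l : seq Ord) : x < a -> uniq l ->
    {subset unzip1 (cnf x) <= l} ->
  h x = (\sum_(xi <- l) h (w xi) *+ coef_cnf x xi)%R.
Proof.
move=> xa l_uniq xl; rewrite emb_cnf//.
under [RHS]eq_bigr do rewrite /coef_cnf -sumrMnr.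
(* After the exchange, each entry of [cnf x] meets exactly one index of the duplicate-free [l]. *)
rewrite (exchange_big_dep xpredT)//= !big_seq; apply: eq_bigr => t tx.
have tl : t.1 \in l by apply: xl; apply/mapP; exists t.
rewrite -big_filter (eq_filter (fun=> eq_sym _ _)).
by rewrite filter_pred1_uniq// big_seq1.
Qed.

Lemma fadd_hsum x y : x < a -> y < a -> add x y = hsum x y.
Proof.
move=> xa ya; rewrite /hsum; set l := sort _ _; set s := map _ _.
have sE : unzip1 s = l by rewrite /unzip1 -map_comp map_id.
have l_uniq : uniq l by rewrite sort_uniq undup_uniq.
have lE xi : (xi \in l) = (xi \in unzip1 (cnf x)) || (xi \in unzip1 (cnf y)).
  by rewrite mem_sort mem_undup mem_cat.
have l_lt xi : xi \in l -> w xi < a.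
  by rewrite lE => /orP[]/mapP[t ts ->]; exact: cnf_exp_lt ts.
have [||sa hs _] := @cnf_valP s.
(* A weakly sorted list without duplicates is strictly sorted; the reversal passes to increasing
   lists, for which this is stated. *)
- rewrite sE -[sorted _ _](rev_sorted <%O) lt_sorted_uniq_le rev_uniq l_uniq.
  by rewrite rev_sorted; apply: sort_sorted => u v; exact: le_total.
- by move=> t /(map_f fst); rewrite [map _ _]sE; exact: l_lt.
apply: emb_eq => //; first exact: fadd_lt.
rewrite hs big_map emb_fadd// (emb_coef_cnf xa l_uniq); last first.
  by move=> xi xx; rewrite lE xx.
rewrite (emb_coef_cnf ya l_uniq); last by move=> xi xy; rewrite lE xy orbT.
by rewrite -big_split; apply: eq_bigr => xi _; rewrite /= mulrnDr.
Qed.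

(** * Property (8) and the natural product *)

Context (h_prod : prod_cofinal a h).

Lemma fmulC x y : mul x y = mul y x.
Proof. by rewrite /fmul mulrC. Qed.

Lemma emb_gt0 x : x < a -> ozero < x -> (0 < h x)%R.
Proof.
by move=> xa x0; rewrite -(emb0 h_emb) emb_ltE//; exact: lt_trans xa.
Qed.

Lemma fmul_lt x y : x < a -> y < a -> mul x y < a.
Proof. by move=> xa ya; have [] := fmulP xa ya. Qed.

Lemma emb_fmul x y : x < a -> y < a -> h (mul x y) = (h x * h y)%R.
Proof. by move=> xa ya; have [] := fmulP xa ya. Qed.

Lemma fmul_ltl x y z : x < a -> y < a -> ozero < x -> z < y ->
  mul z x < mul y x.
Proof.
move=> xa ya x0 zy; have za := lt_trans zy ya.
by rewrite -emb_ltE ?fmul_lt// !emb_fmul// ltr_pM2r ?emb_gt0// emb_ltE.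
Qed.

Lemma fmul_oexp xi eta : w xi < a -> w eta < a ->
  mul (w xi) (w eta) = w (hsum xi eta).
Proof.
elim/olt_ind: xi eta => xi IHxi; elim/olt_ind => eta IHeta xia etaa.
(* The exponents lie in [W a] too, so their natural sum is [add], to which (7) applies. *)
have exp_lt e : w e < a -> e < a by exact: le_lt_trans (oexp_ger e).
have w0 := oexp_gt0.
have sumE e f : w e < a -> w f < a -> hsum e f = add e f.
  by move=> ea fa; rewrite fadd_hsum//; exact: exp_lt.
rewrite sumE//; have [xi_a eta_a] := (exp_lt _ xia, exp_lt _ etaa).
have w_lt e f : e < f -> w f < a -> w e < a.
  by move=> /oexp_ltr; exact: lt_trans.
(* The induction hypotheses extend to finite multiples through [h], since multiples can be moved out
   of a product in [F]. *)
have IHl e n : e < xi -> mul (wn e n) (w eta) = wn (add e eta) n.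
  move=> ex; have ea := w_lt _ _ ex xia.
  have pE : mul (w e) (w eta) = w (add e eta).
    by rewrite IHxi// sumE.
  have pa : w (add e eta) < a by rewrite -pE fmul_lt.
  apply: emb_eq; rewrite ?fmul_lt ?omul_onat_lt//.
  by rewrite emb_fmul ?omul_onat_lt// !emb_oexp_mul// -pE emb_fmul// mulrnAl.
have IHr e n : e < eta -> mul (w xi) (wn e n) = wn (add xi e) n.
  move=> ee; have ea := w_lt _ _ ee etaa.
  have pE : mul (w xi) (w e) = w (add xi e).
    by rewrite IHeta// sumE.
  have pa : w (add xi e) < a by rewrite -pE fmul_lt.
  apply: emb_eq; rewrite ?fmul_lt ?omul_onat_lt//.
  by rewrite emb_fmul ?omul_onat_lt// !emb_oexp_mul// -pE emb_fmul// mulrnAr.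
have pa := fmul_lt xia etaa.
(* A smaller product would lie below some [wn e n] with [e < add xi eta]. By (7), [e <= add f eta]
   with [f < xi], or symmetrically; then [wn e n] is at most [mul (wn f n) (w eta)], which is below
   the product. *)
have ge : w (add xi eta) <= mul (w xi) (w eta).
  rewrite leNgt; apply/negP => /lt_oexp_split[p0|[e [n [e_lt pn]]]].
    have := emb_fmul xia etaa; rewrite p0 (emb0 h_emb) => /esym/eqP.
    by rewrite mulf_eq0 !gt_eqF ?emb_gt0.
  move: pn; rewrite ltNge => /negP; apply.
  have [[f ff ef]|[f ff ef]] := lt_fadd xi_a eta_a e_lt.
    apply: le_trans (omul_lel _ (orec_le _ _ ef)) _; rewrite -[leLHS]IHl//.
    exact/ltW/fmul_ltl/omul_onat_lt_oexp.
  apply: le_trans (omul_lel _ (orec_le _ _ ef)) _; rewrite -[leLHS]IHr//.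
  by rewrite ![mul (w xi) _]fmulC; exact/ltW/fmul_ltl/omul_onat_lt_oexp.
have sa : w (add xi eta) < a by exact: le_lt_trans ge pa.
apply/le_anti; rewrite ge andbT leNgt; apply/negP.
move=> /((h_prod xia etaa).1 _)[v [va [x [y [xx yy hv]]]]].
rewrite leNgt => /negP; apply.
have xa := lt_trans xx xia; have ya := lt_trans yy etaa.
have mul0 z : mul z ozero = ozero.
  rewrite /fmul (emb0 h_emb) mulr0 -(emb0 h_emb) hinvK//.
  exact: lt_trans (w0 xi) xia.
have xs : mul x (w eta) < w (add xi eta).
  have [->|[e [n [e_lt xn]]]] := lt_oexp_split xx.
    by rewrite fmulC mul0.
  have wa : w e < a by exact: w_lt e_lt xia.
  apply: (@lt_trans _ _ (wn (add e eta) n)).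
    by rewrite -IHl//; apply: fmul_ltl; rewrite ?omul_onat_lt.
  by exact/omul_onat_lt_oexp/fadd_ltl.
have ys : mul (w xi) y < w (add xi eta).
  have [->|[e [n [e_lt yn]]]] := lt_oexp_split yy.
    by rewrite mul0.
  have wa : w e < a by exact: w_lt e_lt etaa.
  apply: (@lt_trans _ _ (wn (add xi e) n)).
    rewrite -IHr// ![mul (w xi) _]fmulC.
    by apply: fmul_ltl; rewrite ?omul_onat_lt.
  by exact/omul_onat_lt_oexp/fadd_ltr.
apply: le_lt_trans (fadd_lt_oexp sa ys xs).
rewrite -emb_leE ?fadd_lt ?fmul_lt// emb_fadd ?fmul_lt// !emb_fmul// hv.
by rewrite lerBlDr lerDl mulr_ge0 ?emb_ge0.
Qed.

Lemma emb_big_hsum (I : eqType) (s : seq I) (G : I -> Ord) :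
  (forall i, i \in s -> G i < a) ->
  \big[hsum/ozero]_(i <- s) G i < a /\
  h (\big[hsum/ozero]_(i <- s) G i) = (\sum_(i <- s) h (G i))%R.
Proof.
elim: s => [|i s IH] Ga.
  rewrite !big_nil (emb0 h_emb); split=> //.
  exact: le_lt_trans (ozero_ge0 _) a_gt1.
rewrite !big_cons; have [|sa hs] := IH.
  by move=> j js; apply: Ga; rewrite inE js orbT.
have ia : G i < a by apply: Ga; rewrite inE eqxx.
by rewrite -fadd_hsum// fadd_lt// emb_fadd// hs.
Qed.

(** Under [h], iterated natural sums become sums in [F], so distributivity in [F] expands the
    product of the two normal forms into the double sum of [hprod]; [fmul_oexp] matches the
    terms. *)
Lemma fmul_hprod x y : x < a -> y < a -> mul x y = hprod x y.
Proof.
move=> xa ya; pose G t u : Ord := wn (hsum t.1 u.1) (t.2 * u.2)%N.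
have term t u : t \in cnf x -> u \in cnf y ->
    G t u < a /\ h (G t u) = ((h (w t.1) *+ t.2) * (h (w u.1) *+ u.2))%R.
  move=> /(cnf_exp_lt xa) ta /(cnf_exp_lt ya) ua; rewrite /G.
  have pa := fmul_lt ta ua; rewrite fmul_oexp// in pa.
  rewrite omul_onat_lt// emb_oexp_mul// -fmul_oexp// emb_fmul//.
  by rewrite mulrnAl mulrnAr -mulrnA mulnC.
have row t : t \in cnf x -> \big[hsum/ozero]_(u <- cnf y) G t u < a /\
    h (\big[hsum/ozero]_(u <- cnf y) G t u) = ((h (w t.1) *+ t.2) * h y)%R.
  move=> tx; have [|ra ->] := @emb_big_hsum _ (cnf y) (G t).
    by move=> u uy; have [] := term t u tx uy.
  split=> //; rewrite (emb_cnf ya) mulr_sumr; apply: eq_big_seq => u uy.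
  by have [] := term t u tx uy.
have [|pa hp] := @emb_big_hsum _ (cnf x)
    (fun t => \big[hsum/ozero]_(u <- cnf y) G t u).
  by move=> t tx; have [] := row t tx.
apply: emb_eq; rewrite ?fmul_lt// hp emb_fmul// {1}(emb_cnf xa) mulr_suml.
by apply: eq_big_seq => t tx; have [_ ->] := row t tx.
Qed.

End cofinality.
End field_inherited_operations.

Theorem corollary10 (lambda a : Ord)
  (a_principal : a = oexp omega (oexp omega lambda))
  (F : realFieldType) (h : Ord -> F) (h_emb : field_embedding a h)
  (h_sum : sum_cofinal a h) (h_prod : prod_cofinal a h) :
  forall x y : Ord, W a x -> W a y ->
    fadd a h x y = hsum x y /\ fmul a h x y = hprod x y.
Proof.
move=> x y xa ya.
have a_gt1 : onat 1 < a.
  by rewrite a_principal -(oexp0 omega) oexp_ltr// oexp_gt0.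
by rewrite (fadd_hsum h_emb)// (fmul_hprod h_emb).
Qed.
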